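(* Define $\Phi:\mathcal P(\mathcal P(\mathcal T))\to\mathcal P(\mathbf E)$ by $\Phi(K):=\{E(\mathcal W):\mathcal W\subseteq K\}$ and $\Delta:\mathcal P(\mathbf E)\to\mathcal P(\mathcal P(\mathcal T))$ by $\Delta(\mathcal F):=\{S\subseteq\mathcal T:\overline{\mathbf D}_S\in\mathcal F\}$. Then for all SDSes $K,K_1,K_2\subseteq\mathcal P(\mathcal T)$ and all $\mathcal F,\mathcal F_1,\mathcal F_2\subseteq\mathbf E$: (i) if $K$ is a coherent SDS then $\Phi(K)$ is a proper principal filter on $(\mathbf E,\subseteq)$; (ii) if $\mathcal F$ is a proper principal filter on $(\mathbf E,\subseteq)$ then $\Delta(\mathcal F)$ is a coherent SDS; (iii) if $K$ is a coherent SDS then $\Delta(\Phi(K))=K$; (iv) if $\mathcal F$ is a proper principal filter on $(\mathbf E,\subseteq)$ then $\Phi(\Delta(\mathcal F))=\mathcal F$; (v) if $K_1\subseteq K_2$ then $\Phi(K_1)\subseteq\Phi(K_2)$; (vi) if $\mathcal F_1\subseteq\mathcal F_2$ then $\Delta(\mathcal F_1)\subseteq\Delta(\mathcal F_2)$; (vii) $\Phi(\{S\subseteq\mathcal T:S\cap\mathcal T_+\neq\emptyset\})=\{\overline{\mathbf D}\}$ and $\Phi(\mathcal P(\mathcal T))=\mathbf E$; (viii) $\Delta(\{\overline{\mathbf D}\})=\{S\subseteq\mathcal T:S\cap\mathcal T_+\neq\emptyset\}$ and $\Delta(\mathbf E)=\mathcal P(\mathcal T)$. Hence $\Phi$ is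 an order isomorphism between $(\mathbf K,\subseteq)$, where $\mathbf K$ is the set of all coherent SDSes together with $\mathcal P(\mathcal T)$, and the set $(\mathbf P(\mathbf E),\subseteq)$ of all principal filters on $\mathbf E$, with inverse $\Delta$.
   Context: Let $\mathcal T$ be a non-empty set (of ''things''), $\mathrm{cl}:\mathcal P(\mathcal T)\to\mathcal P(\mathcal T)$ a closure operator (extensive, monotone, idempotent), $\mathcal T_-\subseteq\mathcal T$ a set of forbidden things, $\mathcal T_+:=\mathrm{cl}(\emptyset)$, with standing assumption $\mathcal T_+\cap\mathcal T_-=\emptyset$. A coherent SDT is a $D\subseteq\mathcal T$ with $\mathrm{cl}(D)=D$ and $D\cap\mathcal T_-=\emptyset$; $\overline{\mathbf D}$ is the set of all coherent SDTs. For $\mathcal W\subseteq\mathcal P(\mathcal T)$, $\Sigma_{\mathcal W}$ is the set of maps $\sigma:\mathcal W\to\mathcal T$ with $\sigma(S)\in S$ for all $S\in\mathcal W$, and $\sigma(\mathcal W):=\{\sigma(S):S\in\mathcal W\}$. An SDS is any $K\subseteq\mathcal P(\mathcal T)$. It is coherent if (K1) $\emptyset\notin K$; (K2) if $S_1\in K$ and $S_1\subseteq S_2\subseteq\mathcal T$ then $S_2\in K$; (K3) if $S\in K$ then $S\setminus\mathcal T_-\in K$; (K4) $\{t\}\in K$ for all $t\in\mathcal T_+$; (K5) for every non-empty $\mathcal W\subseteq K$ and every family $(t_\sigma)_{\sigma\in\Sigma_{\mathcal W}}$ with $t_\sigma\in\mathrm{cl}(\sigma(\mathcal W))$, $\{t_\sigma:\sigma\in\Sigma_{\mathcal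 W}\}\in K$. For $S\subseteq\mathcal T$ let $\overline{\mathbf D}_S:=\{D\in\overline{\mathbf D}:S\cap D\neq\emptyset\}$, for $\mathcal W\subseteq\mathcal P(\mathcal T)$ let $E(\mathcal W):=\bigcap_{S\in\mathcal W}\overline{\mathbf D}_S$ (with $E(\emptyset)=\overline{\mathbf D}$), and $\mathbf E:=\{E(\mathcal W):\mathcal W\subseteq\mathcal P(\mathcal T)\}$, ordered by inclusion (a complete lattice with intersection as meet, union as join, bottom $\emptyset$, top $\overline{\mathbf D}$). A principal filter on $\mathbf E$ is a set of the form $\{E'\in\mathbf E:E(\mathcal W)\subseteq E'\}$ for some $\mathcal W\subseteq\mathcal P(\mathcal T)$; it is proper if it is not all of $\mathbf E$, i.e. if $E(\mathcal W)\neq\emptyset$. *)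

(* Defs.v *)
From mathcomp Require Import all_boot.
From mathcomp Require Import boolp classical_sets functions.

Set Implicit Arguments.
Unset Strict Implicit.
Unset Printing Implicit Defensive.

Local Open Scope classical_set_scope.

Record closure_operator (T : Type) (cl : set T -> set T) : Prop := {
  cl_extensive : forall A, A `<=` cl A;
  cl_monotone : forall A B, A `<=` B -> cl A `<=` cl B;
  cl_idempotent : forall A, cl (cl A) = cl A }.

(* The set of things is the whole type T; [Tminus] is the set of forbidden
   things throughout. *)
Definition Tplus (T : Type) (cl : set T -> set T) : set T := cl set0.

Definition coherent_SDT (T : Type) (cl : set T -> set T) (Tminus D : set T) :
  Prop := cl D = D /\ D `&` Tminus = set0.

Definition Dbar (T : Type) (cl : set T -> set T) (Tminus : set T) :
  set (set T) := [set D | coherent_SDT cl Tminus D].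

(* A selection is defined on (the subtype of) the members of W only, so that
   two selections differ only if they differ on W. *)
Definition selections (T : Type) (W : set (set T)) : set (W -> T) :=
  [set sigma | forall S : W, (val S : set T) (sigma S)].
Arguments selections {T} W.

Record coherent_SDS (T : Type) (cl : set T -> set T) (Tminus : set T)
    (K : set (set T)) : Prop := {
  SDS_K1 : ~ K set0;
  SDS_K2 : forall S1 S2, K S1 -> S1 `<=` S2 -> K S2;
  SDS_K3 : forall S, K S -> K (S `\` Tminus);
  SDS_K4 : forall t, Tplus cl t -> K [set t];
  (* Only the values of t on [selections W] are used. *)
  SDS_K5 : forall W : set (set T), W !=set0 -> W `<=` K ->
    forall t : (W -> T) -> T,
      (forall sigma, selections W sigma -> cl (range sigma) (t sigma)) ->
      K [set t sigma | sigma in selections W] }.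

Definition Dmeet (T : Type) (cl : set T -> set T) (Tminus S : set T) :
  set (set T) := [set D | Dbar cl Tminus D /\ S `&` D !=set0].

(* The intersection is taken inside Dbar, so that the empty W yields Dbar. *)
Definition event (T : Type) (cl : set T -> set T) (Tminus : set T)
  (W : set (set T)) : set (set T) :=
  Dbar cl Tminus `&` \bigcap_(S in W) Dmeet cl Tminus S.

Definition events (T : Type) (cl : set T -> set T) (Tminus : set T) :
  set (set (set T)) := range (event cl Tminus).

Definition principal_filter (T : Type) (cl : set T -> set T) (Tminus : set T)
    (F : set (set (set T))) : Prop :=
  exists W : set (set T),
    F = [set E' | events cl Tminus E' /\ event cl Tminus W `<=` E'].

Definition proper_principal_filter (T : Type) (cl : set T -> set T)
    (Tminus : set T) (F : set (set (set T))) : Prop :=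
  principal_filter cl Tminus F /\ F <> events cl Tminus.

Definition Phi (T : Type) (cl : set T -> set T) (Tminus : set T)
  (K : set (set T)) : set (set (set T)) :=
  [set event cl Tminus W | W in [set W | W `<=` K]].

Definition Delta (T : Type) (cl : set T -> set T) (Tminus : set T)
  (F : set (set (set T))) : set (set T) :=
  [set S | F (Dmeet cl Tminus S)].

Lemma Phi_sub_events (T : Type) (cl : set T -> set T) (Tminus : set T)
  (K : set (set T)) : Phi cl Tminus K `<=` events cl Tminus.
Proof. by move=> _ [W _ <-]; exists W. Qed.

Definition coherent_SDSs_top (T : Type) (cl : set T -> set T)
  (Tminus : set T) : set (set (set T)) :=
  [set K | coherent_SDS cl Tminus K] `|` [set [set: set T]].

Definition principal_filters (T : Type) (cl : set T -> set T)
  (Tminus : set T) : set (set (set (set T))) :=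
  [set F | principal_filter cl Tminus F].

Record inclusion_isomorphism (X Y : Type) (A : set (set X)) (B : set (set Y))
    (f : set X -> set Y) (g : set Y -> set X) : Prop := {
  iso_bij : set_bij A B f;
  iso_mono : forall x y, A x -> A y -> (x `<=` y <-> f x `<=` f y);
  iso_inv_fun : set_fun B A g;
  iso_inv_left : forall x, A x -> g (f x) = x;
  iso_inv_right : forall y, B y -> f (g y) = y }.

(* Main.v *)
(* Everything rests on the coherent sets [cl (range sigma)] generated by the
   selections [sigma] of a family [W] of members of a coherent SDS [K].  If every
   coherent SDT meeting all members of [W] also meets [S], then each selection
   generates a set that either meets [S] or meets the forbidden things, and (K5)
   applied to such meeting points, followed by (K3) and (K2), puts [S] in [K].
   Hence [K] consists exactly of those [S] whose [Dmeet S] contains [event K],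
   and [Phi K] is the principal filter generated by [event K]. *)
Require Import Defs.
From mathcomp Require Import all_boot.
From mathcomp Require Import boolp classical_sets functions.

Local Open Scope classical_set_scope.

Section Events.
Local Set Implicit Arguments.
Local Unset Strict Implicit.
Context {T : Type} (cl : set T -> set T) (Tminus : set T).

Local Notation Dbar := (Dbar cl Tminus).
Local Notation Dmeet := (Dmeet cl Tminus).
Local Notation event := (event cl Tminus).
Local Notation events := (events cl Tminus).
Local Notation Phi := (Phi cl Tminus).
Local Notation Delta := (Delta cl Tminus).

(** * Events and the principal filters they generate *)

Definition event_filter (W : set (set T)) : set (set (set T)) :=
  [set E | events E /\ event W `<=` E].

Lemma event1 S : event [set S] = Dmeet S.
Proof.
apply/seteqP; split=> D; first by case=> _ /(_ S erefl).
by move=> DS; split=> [|_ ->//]; case: DS.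
Qed.

Lemma events_Dmeet S : events (Dmeet S).
Proof. by exists [set S] => //; exact: event1. Qed.

Lemma Dmeet0 : Dmeet set0 = set0.
Proof. by rewrite -subset0 => D [_ [x []]]. Qed.

(** An event is an intersection, so inclusion in [event V] is tested on one member of [V] at a time.
    The set on the right is [Delta (event_filter W)], which is why [Phi] undoes [Delta]. *)
Lemma subset_event W V :
  event W `<=` event V <-> V `<=` [set S | event W `<=` Dmeet S].
Proof.
split=> [WV S VS D /WV[_]|WV D WD]; first exact.
by split=> [|S VS]; [case: WD | exact: WV WD].
Qed.

Lemma event_anti V W : V `<=` W -> event W `<=` event V.
Proof. by move=> VW D [DD WD]; split=> // S /VW; exact: WD. Qed.

Lemma Delta_event_filter W :
  Delta (event_filter W) = [set S | event W `<=` Dmeet S].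
Proof.
by apply/seteqP; split=> S /= => [[]//|WS]; split=> //; exact: events_Dmeet.
Qed.

Lemma Delta_event_filterK W : Phi (Delta (event_filter W)) = event_filter W.
Proof.
rewrite Delta_event_filter; apply/seteqP; split=> E.
  by case=> V VW <-; split; [exists V | exact/subset_event].
by case=> -[V _ <-] /subset_event WV; exists V.
Qed.

Lemma event_filter_proper W :
  event_filter W <> events <-> event W !=set0.
Proof.
split=> [WE|[D WD] WE].
  apply: contrapT => W0; apply: WE; apply/seteqP; split=> [E []//|E EE].
  by split=> // D WD; case: W0; exists D.
(* The empty event is [Dmeet set0]; a filter containing it has an empty generator. *)
have: event_filter W (Dmeet set0) by rewrite WE; exact: events_Dmeet.
by rewrite Dmeet0 => -[_ /(_ D WD)].
Qed.

Lemma Phi_mono K1 K2 : K1 `<=` K2 -> Phi K1 `<=` Phi K2.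
Proof. by move=> K12 _ [W WK1 <-]; exists W => // S /WK1/K12. Qed.

Lemma Delta_mono F1 F2 : F1 `<=` F2 -> Delta F1 `<=` Delta F2.
Proof. by move=> F12 S; exact: F12. Qed.

Lemma Phi_setT : Phi setT = events.
Proof. by apply/seteqP; split=> E [W _ <-]; exists W. Qed.

Lemma Delta_events : Delta events = setT.
Proof. by apply/seteqP; split=> // S _; exact: events_Dmeet. Qed.

Lemma events_principal : principal_filter cl Tminus events.
Proof.
exists [set set0]; apply/seteqP; split=> [E EE|E []//].
by split=> //; rewrite event1 Dmeet0.
Qed.

(** * From proper principal filters to coherent SDSes *)

Hypothesis cl_closure : closure_operator cl.

Lemma coherent_SDT_cl A : cl A `&` Tminus = set0 -> Dbar (cl A).
Proof. by split=> //; exact: cl_idempotent. Qed.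

Lemma subset_cl_SDT A D : Dbar D -> A `<=` D -> cl A `<=` D.
Proof. by case=> clD _ AD; rewrite -clD; exact: cl_monotone. Qed.

(** For a fixed coherent SDT [D], the sets meeting [D] form a coherent SDS. [Delta (event_filter W)]
    is the intersection of these over [D] in [event W]; having some such [D] secures (K1). *)
Lemma Delta_coherent W : event W !=set0 ->
  coherent_SDS cl Tminus (Delta (event_filter W)).
Proof.
rewrite Delta_event_filter => -[D0 WD0]; split.
- by move=> /(_ D0 WD0); rewrite Dmeet0.
- move=> S1 S2 WS1 S12 D /WS1[DD [t [S1t Dt]]].
  by split=> //; exists t; split=> //; exact: S12.
- move=> S WS D /WS[DD [t [St Dt]]]; split=> //; exists t; split=> //; split=> //.
  by move=> Tt; case: DD => _ D0T; rewrite -[False]/(set0 t) -D0T.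
- move=> t tplus D [DD _]; split=> //; exists t; split=> //.
  by apply: (subset_cl_SDT DD) tplus.
- move=> V _ VW t tcl D WD; have DD : Dbar D by case: WD.
  (* Points where the members of [V] meet [D] form a selection with values in [D], so [t sigma] lies
     in the closed set [D] as well. *)
  have hit (S : V) : exists x, (val S : set T) x /\ D x.
    by case: (VW _ (set_valP S) D WD) => _ [x [Sx Dx]]; exists x.
  have [sigma sigmaP] := choice hit.
  have sel : selections V sigma by move=> S; case: (sigmaP S).
  split=> //; exists (t sigma); split; first by exists sigma.
  apply: (subset_cl_SDT DD) (tcl _ sel) => _ [S _ <-].
  by case: (sigmaP S).
Qed.

(** * From coherent SDSes to filters, and the isomorphism *)

Hypothesis Tplus_Tminus : Tplus cl `&` Tminus = set0.

(** [Tplus cl] is the least coherent SDT, so a set meeting it meets all of them. *)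
Lemma Dmeet_Dbar S : Dmeet S = Dbar <-> S `&` Tplus cl !=set0.
Proof.
split=> [SD|[t [St tplus]]].
  have : Dmeet S (Tplus cl) by rewrite SD; exact: coherent_SDT_cl.
  by case.
apply/seteqP; split=> D; first by case.
move=> DD; split=> //; exists t; split=> //.
by apply: (subset_cl_SDT DD) tplus.
Qed.

Lemma coherent_SDS_event K W S : coherent_SDS cl Tminus K ->
  W `<=` K -> event W `<=` Dmeet S -> K S.
Proof.
move=> Kcoh WK WS.
(* (K5) is silent on the empty family; there [Tplus cl] is the test set and (K4) takes over. *)
have [W0|/set0P Wn0] := eqVneq W set0.
  have /WS[_ [t [St tplus]]] : event W (Tplus cl).
    by rewrite W0; split=> //; exact: coherent_SDT_cl.
  by apply: (SDS_K2 Kcoh (SDS_K4 Kcoh tplus)) => _ ->.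
(* The guard makes the claim hold for every map, as [choice] requires; off the selections any value
   serves. *)
have pick (sigma : W -> T) : exists t, selections W sigma ->
    cl (range sigma) t /\ (S t \/ Tminus t).
  have [sel|nsel] := pselect (selections W sigma); last first.
    by have [S0 WS0] := Wn0; exists (sigma (exist _ S0 (mem_set WS0))).
  have [D0|/set0P[t [clt Tt]]] := eqVneq (cl (range sigma) `&` Tminus) set0.
    (* A closure avoiding [Tminus] is a coherent SDT, and it meets each [R] in [W] at the point
       [sigma] selects there. *)
    have /WS[_ [t [St Dt]]] : event W (cl (range sigma)).
      split=> [|R WR]; first exact: coherent_SDT_cl.
      split; first exact: coherent_SDT_cl.
      pose R' : W := exist _ R (mem_set WR).
      exists (sigma R'); split; first exact: (sel R').
      by apply: cl_extensive => //; exists R'.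
    by exists t => _; split=> //; left.
  by exists t => _; split=> //; right.
have [t tP] := choice pick.
have KT := SDS_K3 Kcoh (SDS_K5 Kcoh Wn0 WK (fun s ss => (tP s ss).1)).
apply: (SDS_K2 Kcoh KT) => _ [[sigma sel <-] nT].
by case: (tP _ sel) => _ [].
Qed.

Lemma Phi_coherent K : coherent_SDS cl Tminus K -> Phi K = event_filter K.
Proof.
move=> Kcoh; apply/seteqP; split=> E.
  by case=> W WK <-; split; [exists W | exact: event_anti].
(* Any [V] whose event contains [event K] already lies in [K], so it is its own witness. *)
case=> -[V _ <-] /subset_event KV; exists V => // S VS.
exact: coherent_SDS_event (KV S VS).
Qed.

(** An empty [event K] would lie in [Dmeet set0], forcing [set0] into [K] against (K1). *)
Lemma event_coherent_neq0 K : coherent_SDS cl Tminus K -> event K !=set0.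
Proof.
move=> Kcoh; apply: contrapT => K0; apply: (SDS_K1 Kcoh).
by apply: (coherent_SDS_event (W := K)) => // D KD; case: K0; exists D.
Qed.

Lemma PhiK K : coherent_SDS cl Tminus K -> Delta (Phi K) = K.
Proof.
move=> Kcoh; rewrite Phi_coherent// Delta_event_filter.
apply/seteqP; split=> S; first exact: coherent_SDS_event.
by move=> KS D [_ /(_ S KS)].
Qed.

Lemma Phi_proper K : coherent_SDS cl Tminus K ->
  proper_principal_filter cl Tminus (Phi K).
Proof.
move=> Kcoh; rewrite Phi_coherent//; split; first by exists K.
by apply/event_filter_proper; exact: event_coherent_neq0.
Qed.

Lemma Delta_proper_coherent F : proper_principal_filter cl Tminus F ->
  coherent_SDS cl Tminus (Delta F).
Proof.
by case=> -[W ->] /event_filter_proper; exact: Delta_coherent.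
Qed.

Lemma DeltaK F : principal_filter cl Tminus F -> Phi (Delta F) = F.
Proof. by case=> W ->; exact: Delta_event_filterK. Qed.

Lemma Phi_meet_Tplus : Phi [set S | S `&` Tplus cl !=set0] = [set Dbar].
Proof.
apply/seteqP; split=> E.
  case=> W WT <- /=; apply/seteqP; split=> D; first by case.
  by move=> DD; split=> // S /WT/Dmeet_Dbar->.
by move=> ->; exists set0 => //; rewrite /Defs.event bigcap_set0 setIT.
Qed.

Lemma Delta_Dbar : Delta [set Dbar] = [set S | S `&` Tplus cl !=set0].
Proof. by apply/seteqP; split=> S /Dmeet_Dbar. Qed.

Lemma Phi_Delta_isomorphism :
  inclusion_isomorphism (coherent_SDSs_top cl Tminus)
    (principal_filters cl Tminus) Phi Delta.
Proof.
have PhiP K : coherent_SDSs_top cl Tminus K -> principal_filter cl Tminus (Phi K).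
  case=> [/Phi_proper[]//|->]; rewrite Phi_setT; exact: events_principal.
have DeltaP F : principal_filter cl Tminus F -> coherent_SDSs_top cl Tminus (Delta F).
  (* The improper filter is the partner of the added top element [setT]. *)
  move=> Fp; have [->|FE] := pselect (F = events).
    by right; exact: Delta_events.
  by left; exact: Delta_proper_coherent.
have PhiKtop K : coherent_SDSs_top cl Tminus K -> Delta (Phi K) = K.
  by case=> [/PhiK//|->]; rewrite Phi_setT Delta_events.
split=> //.
- split=> //.
  + move=> K1 K2 /set_mem K1P /set_mem K2P K12.
    by rewrite -(PhiKtop K1)// K12 PhiKtop.
  + by move=> F Fp; exists (Delta F); [exact: DeltaP | exact: DeltaK].
- move=> K1 K2 K1P K2P; split; first exact: Phi_mono.
  by move=> /Delta_mono; rewrite !PhiKtop.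
- by move=> F; exact: DeltaK.
Qed.

End Events.

Theorem theorem8 (T : Type) (T_nonempty : [set: T] !=set0)
  (cl : set T -> set T) (cl_closure : closure_operator cl)
  (Tminus : set T) (Tplus_Tminus : Tplus cl `&` Tminus = set0) :
  (* (i) *)
  (forall K : set (set T), coherent_SDS cl Tminus K ->
     proper_principal_filter cl Tminus (Phi cl Tminus K)) /\
  (* (ii) *)
  (forall F : set (set (set T)), F `<=` events cl Tminus ->
     proper_principal_filter cl Tminus F ->
     coherent_SDS cl Tminus (Delta cl Tminus F)) /\
  (* (iii) *)
  (forall K : set (set T), coherent_SDS cl Tminus K ->
     Delta cl Tminus (Phi cl Tminus K) = K) /\
  (* (iv) *)
  (forall F : set (set (set T)), F `<=` events cl Tminus ->
     proper_principal_filter cl Tminus F ->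
     Phi cl Tminus (Delta cl Tminus F) = F) /\
  (* (v) *)
  (forall K1 K2 : set (set T), K1 `<=` K2 ->
     Phi cl Tminus K1 `<=` Phi cl Tminus K2) /\
  (* (vi) *)
  (forall F1 F2 : set (set (set T)),
     F1 `<=` events cl Tminus -> F2 `<=` events cl Tminus ->
     F1 `<=` F2 -> Delta cl Tminus F1 `<=` Delta cl Tminus F2) /\
  (* (vii) *)
  (Phi cl Tminus [set S | S `&` Tplus cl !=set0] = [set Dbar cl Tminus] /\
   Phi cl Tminus [set: set T] = events cl Tminus) /\
  (* (viii) *)
  (Delta cl Tminus [set Dbar cl Tminus] = [set S | S `&` Tplus cl !=set0] /\
   Delta cl Tminus (events cl Tminus) = [set: set T]) /\
  inclusion_isomorphism
    (coherent_SDSs_top cl Tminus) (principal_filters cl Tminus)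
    (Phi cl Tminus) (Delta cl Tminus).
Proof.
split; first exact: Phi_proper.
split; first by move=> F _; exact: Delta_proper_coherent.
split; first exact: PhiK.
split; first by move=> F _ [Fp _]; exact: DeltaK.
split; first exact: Phi_mono.
split; first by move=> F1 F2 _ _; exact: Delta_mono.
split; first by split; [exact: Phi_meet_Tplus | exact: Phi_setT].
split; first by split; [exact: Delta_Dbar | exact: Delta_events].
exact: Phi_Delta_isomorphism.
Qed.
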